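(* Let $p$ be a prime number, $\nu,\eta\in\mathbb{N}$ with $0<\nu\le\eta\le2\nu$, $u:=p^{\nu}$, $v:=p^{\eta}$, $t:=p^{\eta-\nu}$, $u':=p^{2\nu-\eta}$, and assume $2<u<v$. Let $\mathcal{A}=(\mathbb{Z}/v\mathbb{Z};\cdot)$ be the linear cycle set with $\imath\cdot\jmath:=(1-u\imath)\jmath$, and let $\Gamma$ be an additive abelian group. For $\gamma,\gamma_1\in\Gamma$ with $v\gamma_1=u\gamma$, let $(\gamma_r)_{r\in\mathbb{Z}}$ be the $v$-periodic family in $\Gamma$ determined by $\gamma_1,\gamma$ as described in the context, and define maps $\overline{\xi}^1_{\gamma},\overline{\xi}^2_{\gamma_1,\gamma}\colon\mathbb{Z}/v\mathbb{Z}\times\mathbb{Z}/v\mathbb{Z}\to\Gamma$ by (with $0\le\imath_1,\imath_2<v$) $$\overline{\xi}^1_{\gamma}(\imath_1,\imath_2):=\begin{cases}\gamma&\text{if }\imath_1=\imath_2=1,\\-\gamma&\text{if }\imath_1,\imath_2\ge 2\text{ and }\imath_1+\imath_2\le v+1,\\0&\text{otherwise,}\end{cases}$$ and, for $0\le\imath<u$, $0\le\jmath<t$ and $0\le \imath_1<v$, $$\overline{\xi}^2_{\gamma_1,\gamma}(t\imath+\jmath,\imath_1):=\imath_1\Bigl(\imath-u'\tbinom{\jmath}{2}\Bigr)(t\gamma_1-\gamma)+\sum_{l=0}^{\jmath-1}\gamma_{\imath_1-ul\imath_1}.$$ Then: (1) For all such $\gamma,\gamma_1$, the set $\Gamma\times\mathbb{Z}/v\mathbb{Z}$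 is a linear cycle set via $$(c,\imath)+(c',\imath'):=\bigl(c+c'+\overline{\xi}^1_{\gamma}(\imath,\imath'),\imath+\imath'\bigr),\qquad (c,\imath)\cdot(c',\imath'):=\bigl(c'+\overline{\xi}^2_{\gamma_1,\gamma}(\imath,\imath'),\imath\cdot\imath'\bigr),$$ and, with $\iota(c):=(c,0)$ and $\pi(c,\imath):=\imath$, the sequence $0\to\Gamma\xrightarrow{\iota}\Gamma\times\mathbb{Z}/v\mathbb{Z}\xrightarrow{\pi}\mathbb{Z}/v\mathbb{Z}\to 0$ is a central extension of $\mathcal{A}$ by $\Gamma$. (2) The extensions associated with $(\overline{\xi}^1_{\gamma},\overline{\xi}^2_{\gamma_1,\gamma})$ and $(\overline{\xi}^1_{\gamma'},\overline{\xi}^2_{\gamma'_1,\gamma'})$ are equivalent if and only if $\gamma_1-\gamma'_1\in u\Gamma$ and $t(\gamma_1-\gamma'_1)=\gamma-\gamma'$; and each central extension of $\mathcal{A}$ by $\Gamma$ is equivalent to one of these.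
   Context: A linear cycle set is an abelian group $(A,+)$ with a binary operation $\cdot$ such that every left translation $a\mapsto a'\cdot a$ is bijective and, for all $a,b,c\in A$, $(a\cdot b)\cdot(a\cdot c)=(b\cdot a)\cdot(b\cdot c)$, $a\cdot(b+c)=a\cdot b+a\cdot c$ and $(a+b)\cdot c=(a\cdot b)\cdot(a\cdot c)$. Morphisms preserve $+$ and $\cdot$. A central extension of a linear cycle set $A$ by an abelian group $\Gamma$ is a short exact sequence $0\to\Gamma\xrightarrow{\iota}E\xrightarrow{\pi}A\to0$ of linear cycle sets (i.e. of morphisms of linear cycle sets, exact as a sequence of abelian groups), where $\Gamma$ carries the trivial operation $c\cdot c'=c'$, and $\iota(\Gamma)$ is central in $E$: $\iota(c)\cdot e=e$ and $e\cdot\iota(c)=\iota(c)$ for all $c\in\Gamma$, $e\in E$. Two central extensions $E,E'$ of $A$ by $\Gamma$ are equivalent if there is an isomorphism of linear cycle sets $E\to E'$ compatible with the maps from $\Gamma$ and to $A$. The family $(\gamma_r)_{r\in\mathbb{Z}}$: it is $v$-periodic in $r$ (indices are reduced modulo $v$ to $\{0,\dots,v-1\}$), $\gamma_0=0$, $\gamma_1$ is the given element, and for $2\le r<v$ one sets $\gamma_{kt+l}=(kt+l)\gamma_1-(k+1)\gamma$, where $r=kt+l$ is written with $(k,l)$ in the following ranges. If $v=u^2$ (i.e. $t=u$): $k=0$ and $2\le l\le t$; or $k=1$ and $1\le l\le t+2$; or $2\le k<t-1$ and $k<l\le t+k+1$. If $v<u^2$ (i.e. $1<t<u$): $k=0$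 and $2\le l\le t$; or $1\le k<u'$ and $1\le l\le t$; or $k=u'$ and $1\le l\le t+1$; or $u'<k\le 2u'-2$ and $2\le l\le t+1$; or $k=hu'-1$ and $h\le l\le t+h$ for some $2\le h<t$; or $hu'\le k\le(h+1)u'-2$ and $h<l\le t+h$ for some $2\le h<t$. *)

(* Defs.v *)
From mathcomp Require Import all_boot all_order all_algebra.

Set Implicit Arguments.
Unset Strict Implicit.
Unset Printing Implicit Defensive.

Import GRing.Theory.

Local Open Scope ring_scope.

(* Bare operations: the carrier of a central extension gets its addition
   together with its cycle set operation, so that both are tested by the
   predicate [is_lcs] instead of being carried by a structure. *)
Record lcsData := LcsData {
  lcs_sort :> Type;
  lcs_zero : lcs_sort;
  lcs_add : lcs_sort -> lcs_sort -> lcs_sort;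
  lcs_dot : lcs_sort -> lcs_sort -> lcs_sort
}.

Definition is_abelian_group (T : Type) (zero : T) (add : T -> T -> T) : Prop :=
  [/\ associative add, commutative add, left_id zero add
    & forall x, exists y, add y x = zero].

Definition is_lcs (A : lcsData) : Prop :=
  let add := @lcs_add A in
  let dot := @lcs_dot A in
  is_abelian_group (lcs_zero A) add /\
  [/\ forall a, bijective (dot a),
      forall a b c, dot (dot a b) (dot a c) = dot (dot b a) (dot b c),
      forall a b c, dot a (add b c) = add (dot a b) (dot a c)
    & forall a b c, dot (add a b) c = dot (dot a b) (dot a c)].

Definition is_lcs_morphism (A B : lcsData) (f : A -> B) : Prop :=
  (forall x y, f (lcs_add x y) = lcs_add (f x) (f y)) /\
  (forall x y, f (lcs_dot x y) = lcs_dot (f x) (f y)).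

Definition trivial_lcs (Gamma : zmodType) : lcsData :=
  @LcsData Gamma 0 +%R (fun _ c' => c').

Record extension (Gamma : zmodType) (A : lcsData) := Extension {
  ext_total : lcsData;
  ext_incl : trivial_lcs Gamma -> ext_total;
  ext_proj : ext_total -> A
}.

Definition is_short_exact (Gamma : zmodType) (A : lcsData)
    (X : extension Gamma A) : Prop :=
  [/\ injective (@ext_incl _ _ X),
      forall e, ext_proj e = lcs_zero A <-> exists c, e = ext_incl X c
    & forall a, exists e, @ext_proj _ _ X e = a].

Definition is_central_extension (Gamma : zmodType) (A : lcsData)
    (X : extension Gamma A) : Prop :=
  [/\ is_lcs A /\ is_lcs (ext_total X),
      is_lcs_morphism (@ext_incl _ _ X),
      is_lcs_morphism (@ext_proj _ _ X),
      is_short_exact X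
    & forall c e, lcs_dot (ext_incl X c) e = e /\
                  lcs_dot e (ext_incl X c) = ext_incl X c].

Definition ext_equivalent (Gamma : zmodType) (A : lcsData)
    (X Y : extension Gamma A) : Prop :=
  exists f : ext_total X -> ext_total Y,
    [/\ bijective f,
        is_lcs_morphism f,
        forall c, f (ext_incl X c) = ext_incl Y c
      & forall e, ext_proj (f e) = ext_proj e].

Definition cyclic_lcs (u v : nat) : lcsData :=
  @LcsData 'Z_v 0 +%R (fun i j => (1 - u%:R * i) * j).

Definition kl_range (u v t u' k l : nat) : bool :=
  (if v == u ^ 2 then
     [|| (k == 0) && (2 <= l <= t),
         (k == 1) && (1 <= l <= t + 2)
       | (2 <= k < t - 1) && (k < l <= t + k + 1)]
   else
     [|| (k == 0) && (2 <= l <= t),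
         (1 <= k < u') && (1 <= l <= t),
         (k == u') && (1 <= l <= t + 1),
         (u' < k <= 2 * u' - 2) && (2 <= l <= t + 1),
         [exists h : 'I_t, [&& 2 <= h, k == h * u' - 1 & h <= l <= t + h]]
       | [exists h : 'I_t, [&& 2 <= h, h * u' <= k <= (h + 1) * u' - 2
                             & h < l <= t + h]]])%N.

(* The values for 0 <= r < v. For u = p ^ nu, v = p ^ eta, t = v / u and
   u' = u / t with 2 < u < v <= u ^ 2, every r with 2 <= r < v has exactly one
   decomposition r = k t + l with (k, l) in range, so that the last branch is
   never taken. *)
Definition gamma_rep (u v t u' : nat) (Gamma : zmodType) (g1 g : Gamma)
    (r : nat) : Gamma :=
  if r == 0%N then 0 else
  if r == 1%N then g1 else
  if [pick k : 'I_v | (k * t <= r)%N && kl_range u v t u' k (r - k * t)%N]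
    is Some k then g1 *+ r - g *+ k.+1
  else 0.

Definition gamma_fam (u v t u' : nat) (Gamma : zmodType) (g1 g : Gamma)
    (r : int) : Gamma :=
  gamma_rep u v t u' g1 g `|(r %% v%:Z)%Z|%N.

(* The arguments i1, i2 are the representatives in {0, ..., v - 1}; their sum
   is taken in nat. *)
Definition xi1 (v : nat) (Gamma : zmodType) (g : Gamma) (i1 i2 : nat) : Gamma :=
  if (i1 == 1%N) && (i2 == 1%N) then g
  else if [&& 2 <= i1, 2 <= i2 & i1 + i2 <= v + 1]%N then - g
  else 0.

Definition xi2 (u v t u' : nat) (Gamma : zmodType) (g1 g : Gamma)
    (n i1 : nat) : Gamma :=
  let i := (n %/ t)%N in
  let j := (n %% t)%N in
  (g1 *+ t - g) *~ (i1%:Z * (i%:Z - u'%:Z * 'C(j, 2)%:Z))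
  + \sum_(0 <= l < j)
      gamma_fam u v t u' g1 g (i1%:Z - u%:Z * l%:Z * i1%:Z).

Definition xi_lcs (u v t u' : nat) (Gamma : zmodType) (g1 g : Gamma)
    : lcsData :=
  @LcsData (Gamma * 'Z_v)%type (0, 0)
    (fun x y => (x.1 + y.1 + xi1 v g x.2 y.2, x.2 + y.2))
    (fun x y => (y.1 + xi2 u v t u' g1 g x.2 y.2,
                 @lcs_dot (cyclic_lcs u v) x.2 y.2)).

Definition xi_ext (u v t u' : nat) (Gamma : zmodType) (g1 g : Gamma)
    : extension Gamma (cyclic_lcs u v) :=
  @Extension Gamma (cyclic_lcs u v) (xi_lcs u v t u' g1 g)
    (fun c => (c, 0)) (fun x => x.2).

(* Main.v *)
Require Import Defs.
From HB Require Import structures.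
From mathcomp Require Import all_boot all_order all_algebra.
From mathcomp Require Import boolp zify ring.

(* The total space of a central extension is generated by Gamma and an element
   e over 1, with v e = g, i.e. it is (Gamma + Z e) / (v e - g); the pairs
   (c, n) : Gamma * int below stand for c + n e. If e . e = e - d, where
   d = u e - g1, then v d = 0 and e . d = (1 - u) d. The left translation by x
   depends only on the class i of x in Z/v, and translations compose along
   i o j = i + j + u i j, for which 1 generates Z/v because u > 2; hence
   i . e = e - w(i) d with w(i) = i - u i (i - 1), which determines the
   extension by (g1, g), and conversely this formula defines an action because
   u ^ 2 = 0 mod v. Replacing e by e + c changes (g1, g) by (u c, v c), and the
   cocycles xi1, xi2 are those of the section 0, e, n e - g (2 <= n < v). *)

Set Implicit Arguments.
Unset Strict Implicit.
Unset Printing Implicit Defensive.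

Import GRing.Theory.

Local Open Scope ring_scope.

Lemma bin2_int (j : nat) : 'C(j, 2)%:Z * 2 = j%:Z * (j%:Z - 1).
Proof.
case: j => [|j] //; have := mul_bin_diag j.+1 1; rewrite /= bin1 => h.
rewrite -PoszM mulnC -h PoszM; lia.
Qed.

Lemma muln_gt2 (t u : nat) : (1 < t)%N -> (2 < u)%N -> (2 < t * u)%N.
Proof. by nia. Qed.

(** * Carries of the section over [Z/v] *)

Section Carry.
Variables (v : nat) (v_gt0 : (0 < v)%N).

(* In the total space n e = s (n mod v) + carry n * g, where s is the section
   0, e, 2 e - g, ..., (v - 1) e - g. *)
Definition carry (n : int) : int := ((n - 2) %/ v%:Z)%Z + 1.

Lemma carryP (q n : int) : (q - 1) * v%:Z <= n - 2 < q * v%:Z -> carry n = q.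
Proof. by rewrite /carry => ?; nia. Qed.

Lemma carryDv (n k : int) : carry (n + k * v%:Z) = carry n + k.
Proof.
rewrite /carry.
rewrite (_ : n + _ - 2 = k * v%:Z + (n - 2)); last by ring.
by rewrite divzMDl; [ring | lia].
Qed.
End Carry.

(** * The ranges of [(k, l)] as a floor condition *)

Lemma kl_ineq_sqr (t k l : nat) : (2 < t)%N -> (2 <= k * t + l < t * t)%N ->
  [|| (k == 0) && (2 <= l <= t),
         (k == 1) && (1 <= l <= t + 2)
       | (2 <= k < t - 1) && (k < l <= t + k + 1)]%N =
  (k * t + l <= l * t + 1 < k * t + t * t + l)%N.
Proof.
move=> t3 kl_bd; apply/idP/idP.
  by case/or3P => ?; nia.
move=> ineq.
have kt : (k + 1 < t)%N by nia.
have [k0|[k1|k2]] : (k = 0)%N \/ (k = 1)%N \/ (2 <= k)%N by lia.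
- by subst k; apply/or3P/Or31; nia.
- by subst k; apply/or3P/Or32; nia.
- by apply/or3P/Or33; nia.
Qed.

(** Bounds the products that [lia] treats as atoms in the next two proofs. *)
Lemma leq_pmul2 (t u' n : nat) : (0 < u')%N -> (0 < t)%N -> (n <= n * u' * t)%N.
Proof. by move=> u0 t0; rewrite -mulnA leq_pmulr // muln_gt0 u0. Qed.

Lemma kl_ineq_nonsqr_sound (t u' k l : nat) : (1 < t)%N -> (1 < u')%N ->
  (2 <= k * t + l < t * (u' * t))%N ->
  [|| (k == 0) && (2 <= l <= t),
         (1 <= k < u') && (1 <= l <= t),
         (k == u') && (1 <= l <= t + 1),
         (u' < k <= 2 * u' - 2) && (2 <= l <= t + 1),
         [exists h : 'I_t, [&& 2 <= h, k == h * u' - 1 & h <= l <= t + h]]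
       | [exists h : 'I_t, [&& 2 <= h, h * u' <= k <= (h + 1) * u' - 2
                             & h < l <= t + h]]]%N ->
  (k * t + l <= l * u' * t + 1 < k * t + t * (u' * t) + l)%N.
Proof.
move=> t_gt1 u'_gt1 kl_bd.
(* Rows [k < u']: the first two ranges. The differences [t - l] and [l - 1] make the bounds linear
   in the products. *)
have low : (k < u')%N -> (0 < l <= t)%N -> (0 < k)%N || (1 < l)%N ->
    (k * t + l <= l * u' * t + 1 < k * t + t * (u' * t) + l)%N.
  move=> ku /andP[l0 lt] kl.
  have [f tE] : exists f, t = (l + f)%N by exists (t - l)%N; lia.
  have e : (t * (u' * t) = l * u' * t + f * u' * t)%N by rewrite {1}tE; ring.
  have [l' lE] : exists l', l = l'.+1 by exists l.-1; lia.
  have e1 : (l * u' * t = u' * t + l' * u' * t)%N by rewrite lE; ring.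
  have : (l' <= l' * u' * t)%N by apply: leq_pmul2; lia.
  have : (k * t + t <= u' * t)%N by rewrite -mulSnr leq_mul2r; lia.
  have : (f <= f * u' * t)%N by apply: leq_pmul2; lia.
  rewrite e; lia.
(* Rows [u' <= k <= 2 u' - 2]: the third and fourth ranges, where [l = 1] occurs only for
   [k = u']. *)
have mid : (u' <= k <= 2 * u' - 2)%N -> (0 < l <= t + 1)%N ->
    (k == u') || (1 < l)%N ->
    (k * t + l <= l * u' * t + 1 < k * t + t * (u' * t) + l)%N.
  move=> ku /andP[l0 lt] kl.
  have [f tE] : exists f, (t + 1 = l + f)%N by exists (t + 1 - l)%N; lia.
  have e : (t * (u' * t) + u' * t = l * u' * t + f * u' * t)%N.
    by rewrite -!mulnDl -tE; ring.
  have [l' lE] : exists l', l = l'.+1 by exists l.-1; lia.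
  have e1 : (l * u' * t = u' * t + l' * u' * t)%N by rewrite lE; ring.
  have : (l' <= l' * u' * t)%N by apply: leq_pmul2; lia.
  have : (u' * t <= k * t)%N by rewrite leq_mul2r; lia.
  have : (f <= f * u' * t)%N by apply: leq_pmul2; lia.
  have : (k * t + 2 * t <= 2 * u' * t)%N by rewrite -mulnDl leq_mul2r; lia.
  case: l' lE e1 => [|l'] lE e1.
    have -> : k = u' by lia.
    rewrite e1; nia.
  have : (l'.+1 * u' * t = u' * t + l' * u' * t)%N by ring.
  have : (l' <= l' * u' * t)%N by apply: leq_pmul2; lia.
  lia.
case/orP=> [?|]; first by apply: low; lia.
case/orP=> [?|]; first by apply: low; lia.
case/orP=> [?|]; first by apply: mid; lia.
case/orP=> [?|]; first by apply: mid; lia.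
case/orP=> /existsP[[h /= ht]] /and3P[h2].
  move=> /eqP kE hl.
  have {}kE : (k + 1 = h * u')%N by nia.
  have kt : (k * t + t = h * u' * t)%N by rewrite -kE; ring.
  have [f fE] : exists f, (l = h + f)%N by exists (l - h)%N; lia.
  have [f' tE] : exists f', t = (f + f')%N by exists (t - f)%N; lia.
  have fu : (f <= f * u' * t)%N by apply: leq_pmul2; lia.
  have fu' : (f' <= f' * u' * t)%N by apply: leq_pmul2; lia.
  have e : (t * (u' * t) = f * u' * t + f' * u' * t)%N by rewrite {1}tE; ring.
  rewrite fE mulnDl mulnDl e; lia.
move=> kE hl.
have {}kE : (h * u' <= k <= (h + 1) * u' - 2)%N by lia.
have kt1 : (h * u' * t <= k * t)%N by rewrite leq_mul2r; lia.
have hu : (u' <= (h + 1) * u')%N by rewrite leq_pmull // addn1.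
have kt2 : (k * t + 2 * t <= (h + 1) * u' * t)%N.
  by rewrite -mulnDl leq_mul2r; lia.
have [f fE] : exists f, (l = h + 1 + f)%N by exists (l - h - 1)%N; lia.
have [f' tE] : exists f', t = (f + f'.+1)%N by exists (t - f).-1; lia.
have fu : (f <= f * u' * t)%N by apply: leq_pmul2; lia.
have fu' : (f' <= f' * u' * t)%N by apply: leq_pmul2; lia.
have e : (t * (u' * t) = f * u' * t + (u' * t + f' * u' * t))%N.
  by rewrite {1}tE; ring.
have e1 : ((h + 1) * u' * t = h * u' * t + u' * t)%N by ring.
rewrite fE mulnDl mulnDl e; lia.
Qed.

Lemma kl_ineq_nonsqr_complete (t u' k l : nat) : (1 < t)%N -> (1 < u')%N ->
  (2 <= k * t + l < t * (u' * t))%N ->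
  (k * t + l <= l * u' * t + 1 < k * t + t * (u' * t) + l)%N ->
  [|| (k == 0) && (2 <= l <= t),
         (1 <= k < u') && (1 <= l <= t),
         (k == u') && (1 <= l <= t + 1),
         (u' < k <= 2 * u' - 2) && (2 <= l <= t + 1),
         [exists h : 'I_t, [&& 2 <= h, k == h * u' - 1 & h <= l <= t + h]]
       | [exists h : 'I_t, [&& 2 <= h, h * u' <= k <= (h + 1) * u' - 2
                             & h < l <= t + h]]]%N.
Proof.
move=> t_gt1 u'_gt1 kl_bd ineq.
have l0 : (0 < l)%N by nia.
have lk : (k <= l * u')%N.
  by rewrite -(leq_pmul2r (ltnW t_gt1)); lia.
have lk' : (1 < l)%N -> (k < l * u')%N.
  by move=> l1; rewrite -(ltn_pmul2r (ltnW t_gt1)); lia.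
have l1k : (u' < k)%N -> (1 < l)%N.
  move=> ku; rewrite ltnNge; apply/negP=> l1.
  by have l_1 : (l = 1)%N; [lia | move: lk; rewrite l_1; lia].
have kut : (k < u' * t)%N by nia.
(* The range is selected by [k + 1 = h u' + s]: [h = 0], or [h = 1] and [s = 0], means [k < u'];
   [h = 1] and [s > 0] means [u' <= k <= 2 u' - 2]; for [h >= 2] this is the [h] of the last two
   ranges, told apart by [s = 0]. *)
set h := ((k + 1) %/ u')%N; set s := ((k + 1) %% u')%N.
have kE : (k + 1 = h * u' + s)%N by apply: divn_eq.
have su : (s < u')%N by apply: ltn_pmod; lia.
move: h s kE su => h s kE su.
have u'_gt0 : (0 < u')%N by lia.
have hl : (1 < l)%N -> (h <= l)%N.
  by move=> /lk' ?; rewrite -(leq_pmul2r u'_gt0); lia.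
have hl' : (1 < l)%N -> (0 < s)%N -> (h < l)%N.
  by move=> /lk' ? ?; rewrite -(ltn_pmul2r u'_gt0); lia.
have ht : (h < t)%N.
  have : (h <= t)%N by rewrite -(leq_pmul2r u'_gt0); lia.
  rewrite leq_eqVlt => /orP[/eqP ht|//]; subst h.
  have s0 : s = 0 by nia.
  have l1 : (1 < l)%N by nia.
  have := hl l1; nia.
have lt : (l <= t + h)%N.
  rewrite leqNgt; apply/negP => lt.
  have [f fE] : exists f, l = (t + h + 1 + f)%N by exists (l - t - h - 1)%N; lia.
  have e : (k * t + t = h * u' * t + s * t)%N by rewrite -mulnDl -kE; ring.
  have fu : (f <= f * u' * t)%N by apply: leq_pmul2; lia.
  have st : (s * t + t <= u' * t)%N by rewrite -mulSnr leq_mul2r su orbT.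
  have e2 : (l * u' * t =
      t * (u' * t) + h * u' * t + u' * t + f * u' * t)%N by rewrite fE; ring.
  move: ineq; rewrite e2; lia.
have [h0|[h1|h2]] : h = 0 \/ h = 1 \/ (1 < h)%N by lia.
- subst h; case: (posnP k) => [k0|k0].
    by apply/orP; left; nia.
  by apply/orP; right; apply/orP; left; lia.
- subst h; case: (posnP s) => [s0|s0].
    have k1 : (k + 1 = u')%N by lia.
    have lt1 : (l <= t)%N by subst u'; nia.
    by apply/orP; right; apply/orP; left; lia.
  apply/orP; right; apply/orP; right.
  by case: (ltngtP u' k) => ?; apply/orP; [right; apply/orP; left| |left]; lia.
- have [l1|l1] := ltnP 1 l; last first.
  by have : (2 * u' <= h * u')%N; [rewrite leq_mul2r h2 orbT | lia].
  do 4 (apply/orP; right).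
  case: (posnP s) => [s0|s0]; apply/orP; [left|right]; apply/existsP;
    exists (Ordinal ht); apply/and3P; split=> //=; have := hl l1; have := hl' l1; lia.
Qed.

Section Range.
Variables (u v t u' : nat).
Hypotheses (v_eq : v = (t * u)%N) (u_eq : u = (u' * t)%N).
Hypotheses (t_gt1 : (1 < t)%N) (u_gt2 : (2 < u)%N).

(* With r = k t + l, the ranges say that k = floor ((r (u - 1) + 1) / v). *)
Lemma kl_rangeE (k l : nat) : (2 <= k * t + l < v)%N ->
  kl_range u v t u' k l = (k * t <= l * (u - 1) + 1 < k * t + v)%N.
Proof.
move=> kl_bd.
(* Adding [l] throughout removes the truncated subtraction, as [l (u - 1) + l = l u' t]. *)
have -> : (k * t <= l * (u - 1) + 1 < k * t + v)%N =
          (k * t + l <= l * u' * t + 1 < k * t + v + l)%N.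
  have -> : (l * u' * t = l * (u - 1) + l)%N.
    by rewrite -mulnA -u_eq -mulnSr subn1 prednK //; lia.
  by apply/idP/idP; lia.
have v_sqr : (v == u ^ 2)%N = (u' == 1)%N.
  rewrite v_eq -mulnn eqn_pmul2r; last by lia.
  by rewrite u_eq; apply/eqP/eqP => [|->]; nia.
rewrite /kl_range v_sqr; case: eqP => u'1.
  have ut : u = t by rewrite u_eq u'1 mul1n.
  rewrite v_eq u'1 muln1 ut; apply: kl_ineq_sqr; first by rewrite -ut.
  by rewrite (_ : t * t = v)%N // v_eq ut.
rewrite v_eq u_eq in kl_bd *.
have u'_gt1 : (1 < u')%N by case: (u') u'1 u_eq => [|[|?]] // _; lia.
by apply/idP/idP; [apply: kl_ineq_nonsqr_sound | apply: kl_ineq_nonsqr_complete].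
Qed.
End Range.

(** * Linear cycle sets from actions, and residues modulo [v] *)

(** If [n + a = 0], then [(a . n) . (a . c) = (a + n) . c = c], so every left translation has a left
    inverse that is again a left translation. The cycle identity expands [(a + b) . c = (b + a) . c]
    in two ways. *)
Lemma is_lcs_of_action (A : lcsData) :
  is_abelian_group (lcs_zero A) (@lcs_add A) ->
  (forall c, lcs_dot (lcs_zero A) c = c) ->
  (forall a b c : A,
     lcs_dot a (lcs_add b c) = lcs_add (lcs_dot a b) (lcs_dot a c)) ->
  (forall a b c : A,
     lcs_dot (lcs_add a b) c = lcs_dot (lcs_dot a b) (lcs_dot a c)) ->
  is_lcs A.
Proof.
move=> abA dot0 dotDr dotDl; have [_ addC _ addN] := abA.
have linv (a : A) : exists b, cancel (lcs_dot a) (lcs_dot b).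
  have [n na] := addN a; exists (lcs_dot a n) => c.
  by rewrite -dotDl addC na dot0.
split=> //; split=> //.
(* The left inverse [lcs_dot b] has a left inverse too, so it is a two-sided inverse. *)
- move=> a; have [b ab] := linv a; have [c bc] := linv b.
  by exists (lcs_dot b) => // x; rewrite -[LHS]bc ab bc.
- by move=> a b c; rewrite -!dotDl addC.
Qed.

Section Zv.
Variables (v : nat) (v_gt1 : (1 < v)%N).

Lemma natr_Zv0 : v%:R = 0 :> 'Z_v.
Proof. exact: pchar_Zp. Qed.

Lemma intr_ZvDv (n k : int) : (n + k * v%:Z)%:~R = n%:~R :> 'Z_v.
Proof. by rewrite intrD intrM -[v%:Z%:~R]/(v%:R) natr_Zv0 mulr0 addr0. Qed.

Lemma ltn_Zv (x : 'Z_v) : (x < v)%N.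
Proof. by rewrite -[X in (_ < X)%N]Zp_cast // ltn_ord. Qed.

Lemma Zv_val_intr (n : int) : exists k : int,
  n = (n%:~R : 'Z_v)%:Z + k * v%:Z.
Proof.
exists (n %/ v%:Z)%Z.
have -> : n%:~R = (n %% v%:Z)%Z%:~R :> 'Z_v.
  by rewrite {1}(divz_eq n v%:Z) addrC intr_ZvDv.
have [m mE] : exists m : nat, (n %% v%:Z)%Z = m by exists `|(n %% v%:Z)%Z|%N; lia.
rewrite mE -[m%:Z%:~R]/(m%:R : 'Z_v) val_Zp_nat // modn_small; last by lia.
by rewrite -mE addrC -divz_eq.
Qed.

Lemma intr_Zv_eq (n m : int) : n%:~R = m%:~R :> 'Z_v ->
  exists k : int, n = m + k * v%:Z.
Proof.
move=> nm; have [k nE] := Zv_val_intr n; have [l mE] := Zv_val_intr m.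
exists (k - l); rewrite [LHS]nE nm [in RHS]mE.
by ring.
Qed.

Lemma Zv_valK (x : 'Z_v) : (x%:Z)%:~R = x.
Proof. exact: natr_Zp. Qed.
End Zv.

(** * The cocycles in terms of carries *)

Section Cocycles.
Variables (u v t u' : nat).
Hypotheses (v_eq : v = (t * u)%N) (u_eq : u = (u' * t)%N).
Hypotheses (t_gt1 : (1 < t)%N) (u_gt2 : (2 < u)%N).
Variables (Gamma : zmodType) (g1 g : Gamma).
Hypothesis rel : g1 *+ v = g *+ u.

Let v_gt2 : (2 < v)%N.
Proof. by rewrite v_eq muln_gt2. Qed.

Let v_gt1 : (1 < v)%N := ltnW v_gt2.
Let v_gt0 : (0 < v)%N := ltnW v_gt1.

(** Since [s(r) = r e - carry(r) g], this is [s(r1) + s(r2) - s(r1 + r2)]. The bound [v + 1] in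
    [xi1] is the last integer before [carry] passes from 1 to 2. *)
Lemma xi1_carry (r1 r2 : nat) : (r1 < v)%N -> (r2 < v)%N ->
  xi1 v g r1 r2 = g *~ (carry v (r1%:Z + r2%:Z) - carry v r1 - carry v r2).
Proof.
move=> h1 h2; rewrite /xi1.
have c0 (n : int) : 2 - v%:Z <= n < 2 -> carry v n = 0.
  by move=> hn; apply: carryP => //; lia.
have c1 (n : int) : 2 <= n < v%:Z + 2 -> carry v n = 1.
  by move=> hn; apply: carryP => //; lia.
have c2 (n : int) : 2 + v%:Z <= n < 2 * v%:Z + 2 -> carry v n = 2.
  by move=> hn; apply: carryP => //; lia.
have [a1|a1] := ltnP r1 2; have [a2|a2] := ltnP r2 2.
- rewrite (c0 r1) ?(c0 r2) //; try lia.
  rewrite andbF.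
  case: ifP => e; first by rewrite c1 //; lia.
  by rewrite c0 //; lia.
- rewrite (c0 r1) ?(c1 r2) //; try lia.
  rewrite c1; last by lia.
  by case: ifP => //; lia.
- rewrite (c1 r1) ?(c0 r2) //; try lia.
  rewrite c1; last by lia.
  by case: ifP => //; try lia; rewrite ?andbF.
- rewrite (c1 r1) ?(c1 r2) //; try lia.
  case: ifP; first by lia.
  case: ifP => e _; first by rewrite c1 //; lia.
  by rewrite c2 //; lia.
Qed.

Definition comb (a b : int) : Gamma := g1 *~ a + g *~ b.

Lemma combD a b a' b' : comb a b + comb a' b' = comb (a + a') (b + b').
Proof. by rewrite /comb !mulrzDr; rewrite addrACA. Qed.

(** By [rel], the coefficient pair [(v, -u)] gives 0. Equalities in [Gamma] thus become two integer
    identities, with [k] the multiple of this pair by which the sides differ. *)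
Lemma comb_eq (k a b a' b' : int) : a = a' + k * v%:Z -> b = b' - k * u%:Z ->
  comb a b = comb a' b'.
Proof.
move=> -> ->; rewrite /comb !mulrzDr !(mulrC k) mulrNz !mulrzA.
by rewrite -!pmulrn rel; rewrite addrACA subrr addr0.
Qed.

(* The Gamma-component of i . s(m) - s((1 - u i) m) when w(i) = W. *)
Definition coc (W m : int) : Gamma :=
  comb (m * W) (carry v (m - m * W * u%:Z) - carry v m).

Lemma coc_modr (W m k : int) : coc W (m + k * v%:Z) = coc W m.
Proof.
apply: (comb_eq (k := k * W)); first by ring.
have -> : m + k * v%:Z - (m + k * v%:Z) * W * u%:Z =
    (m - m * W * u%:Z) + (k - k * W * u%:Z) * v%:Z by ring.
by rewrite !(carryDv v_gt0) //; ring.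
Qed.

Lemma coc_modl (W m k : int) : coc (W + k * v%:Z) m = coc W m.
Proof.
apply: (comb_eq (k := k * m)); first by ring.
have -> : m - m * (W + k * v%:Z) * u%:Z =
    (m - m * W * u%:Z) + (- (k * m * u%:Z)) * v%:Z by ring.
by rewrite !(carryDv v_gt0) //; ring.
Qed.

(** Translations compose: [(1 - W1 u) (1 - W2 u) = 1 - (W1 + W2 - W1 W2 u) u], and the carries
    telescope. *)
Lemma coc_comp (W1 W2 m : int) :
  coc W1 m + coc W2 (m - m * W1 * u%:Z) = coc (W1 + W2 - W1 * W2 * u%:Z) m.
Proof.
rewrite /coc combD; apply: (comb_eq (k := 0)); first by ring.
have -> : m - m * (W1 + W2 - W1 * W2 * u%:Z) * u%:Z =
    m - m * W1 * u%:Z - (m - m * W1 * u%:Z) * W2 * u%:Z by ring.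
by ring.
Qed.

(** As [t u = v], adding [t K] to [W] moves the argument of [carry] by [- K m v]. This is the origin
    of [t g1 - g] in [xi2]. *)
Lemma coc_shift (W K m : int) :
  coc (W + t%:Z * K) m = coc W m + (g1 *+ t - g) *~ (K * m).
Proof.
have -> : (g1 *+ t - g) *~ (K * m) = comb (t%:Z * (K * m)) (- (K * m)).
  by rewrite /comb mulrzBl (mulrzA _ t%:Z) mulrNz -pmulrn.
rewrite /coc combD; apply: (comb_eq (k := 0)); first by ring.
have -> : m - m * (W + t%:Z * K) * u%:Z = (m - m * W * u%:Z) + (- (K * m)) * v%:Z.
  by rewrite v_eq PoszM; ring.
by rewrite (carryDv v_gt0) //; ring.
Qed.

(** For [2 <= r < v], [carry r = 1] and [carry (r - r u) = - k] with
    [k = floor ((r (u - 1) + 1) / v)], whence the coefficient [- (k + 1)] of [g]. By [kl_rangeE] the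
    ranges select exactly this [k]. *)
Lemma gamma_repE (r : nat) : (r < v)%N ->
  gamma_rep u v t u' g1 g r = coc 1 r.
Proof.
move=> rv; rewrite /gamma_rep /coc /comb.
case: eqP => [->|r0]; first by rewrite !mul0r subr0 subrr !mulr0z addr0.
have vu : (u * 2 <= v)%N by rewrite v_eq; nia.
case: eqP => [->|r1].
  rewrite mul1r !(carryP v_gt0 (q := 0)) //; try lia.
  by rewrite subrr mulr0z addr0.
have krange (k : nat) : (k * t <= r)%N ->
    (k * t <= (r - k * t) * (u - 1) + 1 < k * t + v)%N =
    (k * v <= r * (u - 1) + 1 < k.+1 * v)%N.
  move=> kt.
  have [l ->] : exists l, r = (k * t + l)%N by exists (r - k * t)%N; lia.
  rewrite v_eq (_ : (k * t + l - k * t) = l)%N; last by lia.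
  have [w ->] : exists w, u = w.+1 by exists u.-1; lia.
  by rewrite subn1 /=; apply/idP/idP; nia.
case: pickP => [k /andP[kt kl]|no].
  have H : (k * v <= r * (u - 1) + 1 < k.+1 * v)%N.
    by rewrite -krange // -(kl_rangeE v_eq u_eq) // subnKC //; lia.
  rewrite (carryP v_gt0 (q := - k%:Z)) //; last by nia.
  rewrite (carryP v_gt0 (q := 1)) //; last by lia.
  rewrite mulr1 !pmulrn; congr (_ + _).
  by rewrite -mulrNz; congr (_ *~ _); lia.
(* The default value 0 of [gamma_rep] is not reached: the floor passes the range test. *)
exfalso.
set k := ((r * (u - 1) + 1) %/ v)%N.
have kP : (k * v <= r * (u - 1) + 1 < k.+1 * v)%N.
  have := divn_eq (r * (u - 1) + 1) v.
  by have := ltn_pmod (r * (u - 1) + 1) (d := v); rewrite -/k; lia.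
have kt : (k * t <= r)%N by rewrite v_eq in kP; nia.
have kv : (k < v)%N by nia.
have := no (Ordinal kv); rewrite /= kt /= => /negP; apply.
by rewrite (kl_rangeE v_eq u_eq) ?krange // subnKC //; lia.
Qed.

Lemma gamma_famE (r : int) : gamma_fam u v t u' g1 g r = coc 1 r.
Proof.
rewrite /gamma_fam gamma_repE; last by lia.
rewrite [in RHS](divz_eq r v%:Z) addrC coc_modr.
by congr (coc 1 _); lia.
Qed.

Lemma sqr_u : u%:Z * u%:Z = u'%:Z * v%:Z.
Proof. by rewrite v_eq u_eq; lia. Qed.

(** Modulo [v], [m - u l m] is [(1 - u) ^ l m], so by [coc_comp] the sum belongs to the [j]-fold
    composite of the translation with [W = 1]. The composite has [W = j - u 'C(j, 2)] modulo [v],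
    because [v] divides [u ^ 2]. *)
Lemma sum_gamma_fam (j : nat) (m : int) :
  \sum_(0 <= l < j) gamma_fam u v t u' g1 g (m - u%:Z * l%:Z * m)
  = coc (j%:Z - u%:Z * 'C(j, 2)%:Z) m.
Proof.
have sq := sqr_u.
elim: j => [|j IH].
  rewrite big_geq // bin0n mulr0 subr0 /coc mulr0 mul0r subr0 subrr.
  by rewrite /comb !mulr0z addr0.
rewrite big_nat_recr //= {}IH gamma_famE.
set W := j%:Z - _.
have -> : m - u%:Z * j%:Z * m = (m - m * W * u%:Z) + (- (m * 'C(j, 2)%:Z) * u'%:Z) * v%:Z.
  by rewrite -[_ * v%:Z]mulrA -sq /W; ring.
rewrite coc_modr coc_comp.
have -> : W + 1 - W * 1 * u%:Z = (j.+1%:Z - u%:Z * 'C(j.+1, 2)%:Z) + ('C(j, 2)%:Z * u'%:Z) * v%:Z.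
  by rewrite -[_ * v%:Z]mulrA -sq /W binS bin1 PoszD -(addn1 j) PoszD; ring.
by rewrite coc_modl.
Qed.

(** The exponent [w] in [i . e = e - w(i) d]. *)
Definition wt (n : int) : int := n - u%:Z * n * (n - 1).

(** For [n = i t + j], modulo [v], [wt n = (j - u 'C(j, 2)) + t (i - u' 'C(j, 2))]. The first
    summand yields the sum of the gammas, the second, by [coc_shift], the multiple of [t g1 - g]. *)
Lemma xi2E (n m : nat) : xi2 u v t u' g1 g n m = coc (wt n) m.
Proof.
rewrite /xi2 sum_gamma_fam [LHS]addrC.
set i := (n %/ t)%N; set j := (n %% t)%N.
rewrite [X in _ *~ X]mulrC -coc_shift.
have nE : n%:Z = i%:Z * t%:Z + j%:Z by rewrite -PoszM -PoszD -divn_eq.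
(* Chosen so that [u n (n - 1) = 2 u 'C(j, 2) + q v]. *)
pose q : int := i%:Z * (i%:Z * t%:Z + j%:Z * 2 - 1).
apply/esym; rewrite -(coc_modl _ _ q); congr coc.
rewrite /wt nE /q v_eq.
have uE : u%:Z = u'%:Z * t%:Z by rewrite -PoszM -u_eq.
have b2 := bin2_int j.
rewrite PoszM.
transitivity (j%:Z + i%:Z * t%:Z - u%:Z * (j%:Z * (j%:Z - 1))); first by ring.
by rewrite -b2 uE; ring.
Qed.

Lemma sqr_u_Zv : u%:R * u%:R = 0 :> 'Z_v.
Proof.
rewrite -natrM (_ : u * u = u' * v)%N; last by rewrite v_eq {1}u_eq mulnA.
by rewrite natrM natr_Zv0 ?mulr0.
Qed.

Lemma is_lcs_cyclic : is_lcs (cyclic_lcs u v).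
Proof.
apply: is_lcs_of_action => /=.
- split; [exact: addrA | exact: addrC | exact: add0r|].
  by move=> x; exists (- x); rewrite addNr.
- by move=> c; rewrite mulr0 subr0 mul1r.
- by move=> a b c; rewrite mulrDr.
- move=> a b c.
  transitivity ((1 - u%:R * (a + b)) * c + (u%:R * u%:R) * (2 - u%:R * a) * (a * b * c)).
    by rewrite sqr_u_Zv !mul0r addr0.
  by ring.
Qed.

Lemma wt_modv (n k : int) : exists q, wt (n + k * v%:Z) = wt n + q * v%:Z.
Proof.
exists (k - u%:Z * k * (2 * n - 1 + k * v%:Z)); rewrite /wt; ring.
Qed.

(** The axiom [(x + y) . z = (x . y) . (x . z)] at the level of exponents, for [x] over [n] and [y]
    over [m]; then [m'] lies over [x . y]. *)
Lemma wt_comp (n m : int) (m' := m - m * wt n * u%:Z) : exists q,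
  wt n + wt m' - wt n * wt m' * u%:Z = wt (n + m) + q * v%:Z.
Proof.
pose a := wt n.
(* [B] is the quotient of [wt m' - m] by [u]; it collects the terms with a factor [u ^ 2 = u' v]. *)
pose B := - (m * a) - m * (m - 1) + u%:Z * m * a * (2 * m - 1)
  - u%:Z ^+ 2 * m ^+ 2 * a ^+ 2.
exists ((2 * n * (n - 1) * m + m * a * (2 * m - 1)
  - u%:Z * m ^+ 2 * a ^+ 2 - a * B) * u'%:Z).
rewrite -[_ * v%:Z]mulrA -sqr_u /B /a /m' /wt.
by ring.
Qed.

Lemma wt0 : wt 0 = 0. Proof. by rewrite /wt mulr0 mul0r subr0. Qed.
Lemma wt1 : wt 1 = 1. Proof. by rewrite /wt subrr mulr0 subr0. Qed.

(** * The total space in the coordinates [c + n e] *)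

Let E := xi_lcs u v t u' g1 g.

(* The element c + n e of the total space. *)
Definition rho (c : Gamma) (n : int) : E := (c + g *~ carry v n, n%:~R).

Lemma rhoDv (c : Gamma) (n k : int) : rho c (n + k * v%:Z) = rho (c + g *~ k) n.
Proof.
by rewrite /rho carryDv // mulrzDr intr_ZvDv // [_ + g *~ k]addrC addrA.
Qed.

Lemma rho_surj (x : E) : exists c, x = rho c (x.2 : 'Z_v)%:Z.
Proof.
exists (x.1 - g *~ carry v (x.2 : 'Z_v)%:Z).
by rewrite /rho subrK Zv_valK //; case: x.
Qed.

Lemma rho_inj (c c' : Gamma) (n : int) : rho c n = rho c' n -> c = c'.
Proof. by case => /addIr. Qed.

Lemma carry0 : carry v 0 = 0.
Proof. by apply: carryP => //; have := v_gt2; lia. Qed.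

Lemma rho0 (c : Gamma) : rho c 0 = (c, 0).
Proof. by rewrite /rho carry0 mulr0z addr0. Qed.

Lemma rhoD (c c' : Gamma) (n n' : int) :
  lcs_add (rho c n) (rho c' n') = rho (c + c') (n + n').
Proof.
rewrite /rho /= intrD; congr pair.
rewrite xi1_carry ?ltn_Zv //.
have [k nE] := Zv_val_intr v_gt1 n; have [l mE] := Zv_val_intr v_gt1 n'.
set a := (n%:~R : 'Z_v)%:Z in nE *; set b := (n'%:~R : 'Z_v)%:Z in mE *.
clearbody a b.
have -> : carry v n = carry v a + k by rewrite nE carryDv.
have -> : carry v n' = carry v b + l by rewrite mE carryDv.
have -> : carry v (n + n') = carry v (a + b) + (k + l).
  by rewrite nE mE -carryDv //; congr (carry v _); ring.
rewrite addrACA -[LHS]addrA -!mulrzDr.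
by congr (_ + _ *~ _); ring.
Qed.

(* The left translate of c + m e by any element over i with w(i) = W. *)
Definition lam (W : int) (c : Gamma) (m : int) : E :=
  rho (c + g1 *~ (m * W)) (m - m * W * u%:Z).

Lemma lam_modv (W k : int) (c : Gamma) (m : int) :
  lam (W + k * v%:Z) c m = lam W c m.
Proof.
rewrite /lam (_ : m - m * (W + k * v%:Z) * u%:Z =
  (m - m * W * u%:Z) + (- (m * k * u%:Z)) * v%:Z); last by ring.
rewrite rhoDv; congr rho; rewrite -!addrA; congr (_ + _).
transitivity (comb (m * W) 0); last by rewrite /comb mulr0z addr0.
by apply: (comb_eq (k := m * k)); ring.
Qed.

(** With [d = u e - g1], the value [c' + m (e - W d)] is [c' + m W g1 + (m - m W u) e]. The
    projections agree because [wt n] and [n] differ by a multiple of [u], and [u ^ 2 = 0] in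
    ['Z_v]. *)
Lemma rho_dot (c c' : Gamma) (n m : int) :
  lcs_dot (rho c n) (rho c' m) = lam (wt n) c' m.
Proof.
rewrite /lam /rho /= xi2E //.
have -> : coc (wt (n%:~R : 'Z_v)) (m%:~R : 'Z_v)
  = coc (wt n) m.
  have [k nE] := Zv_val_intr v_gt1 n; have [l mE] := Zv_val_intr v_gt1 m.
  rewrite [in RHS]nE [in RHS]mE coc_modr //.
  by have [q ->] := wt_modv (n%:~R : 'Z_v)%:Z k; rewrite coc_modl.
congr pair.
  rewrite /coc /comb mulrzBr -[LHS]addrA -[RHS]addrA; congr (_ + _).
  by rewrite addrCA; congr (_ + _); rewrite addrC subrK.
rewrite intrB !intrM /wt intrB !intrM.
rewrite -[u%:Z%:~R]/(u%:R) -[RHS]addr0.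
set N := n%:~R; set M := m%:~R; set K := (n - 1)%:~R.
transitivity (M - M * (N - u%:R * N * K) * u%:R - u%:R * u%:R * (M * N * K)); first by ring.
by rewrite sqr_u_Zv mul0r oppr0.
Qed.

Lemma lam_comp (W1 W2 : int) (c : Gamma) (m : int) :
  lam W2 (c + g1 *~ (m * W1)) (m - m * W1 * u%:Z) =
  lam (W1 + W2 - W1 * W2 * u%:Z) c m.
Proof.
rewrite /lam -addrA -mulrzDr; congr (rho (_ + _ *~ _) _); ring.
Qed.

Lemma is_lcs_xi : is_lcs E.
Proof.
apply: is_lcs_of_action.
- split=> [x y z|x y|x|x].
  + have [c ->] := rho_surj x; have [d ->] := rho_surj y.
    by have [e ->] := rho_surj z; rewrite !rhoD !addrA.
  + have [c ->] := rho_surj x; have [d ->] := rho_surj y.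
    by rewrite !rhoD addrC [X in rho _ X]addrC.
  + by have [c ->] := rho_surj x; rewrite -[lcs_zero E]rho0 rhoD !add0r.
  + have [c xE] := rho_surj x; exists (rho (- c) (- (x.2 : 'Z_v)%:Z)).
    by rewrite {2}xE rhoD !addNr rho0.
- move=> x; have [c ->] := rho_surj x; rewrite -[lcs_zero E]rho0 rho_dot.
  by rewrite wt0 /lam mulr0 mulr0z addr0 mul0r subr0.
- move=> x y z.
  have [c ->] := rho_surj x; have [d ->] := rho_surj y; have [e ->] := rho_surj z.
  rewrite rhoD !rho_dot /lam rhoD; congr rho; last by ring.
  by rewrite mulrDl mulrzDr addrACA.
- move=> x y z.
  have [c ->] := rho_surj x; have [d ->] := rho_surj y; have [e ->] := rho_surj z.
  rewrite rhoD !rho_dot lam_comp.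
  have [q ->] := wt_comp (x.2 : 'Z_v)%:Z (y.2 : 'Z_v)%:Z.
  by rewrite lam_modv.
Qed.

Lemma xi_central : is_central_extension (xi_ext u v t u' g1 g).
Proof.
have incl0 (c : Gamma) : ext_incl (xi_ext u v t u' g1 g) c = rho c 0.
  by rewrite rho0.
split.
- by split; [exact: is_lcs_cyclic | exact: is_lcs_xi].
- split=> x y; rewrite !incl0; first by rewrite rhoD addr0.
  by rewrite rho_dot wt0 /lam mulr0 addr0 mul0r subr0.
- by split.
- split=> /=; first by move=> x y [].
    by move=> [c a] /=; split=> [->|[d [_ ->]]] //; exists c.
  by move=> a; exists (0, a).
- move=> c e; have [d ->] := rho_surj e.
  by rewrite incl0 !rho_dot /lam wt0 !mulr0 !mul0r !subr0 !addr0.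
Qed.

(** Universal property of [(Gamma + Z e) / (v e - g)]: [F] is additive on pairs and respects
    [v e = g], so it descends; bijectivity is the short five lemma. *)
Lemma ext_equiv_of_lift (X : extension Gamma (cyclic_lcs u v))
    (F : Gamma -> int -> ext_total X) :
  is_central_extension X ->
  (forall c c' n n', F (c + c') (n + n') = lcs_add (F c n) (F c' n')) ->
  (forall c, F c 0 = ext_incl X c) ->
  (forall c n, ext_proj (F c n) = n%:~R) ->
  (forall c n, F c (n + v%:Z) = F (c + g) n) ->
  (forall c c' n m, lcs_dot (F c n) (F c' m) =
     F (c' + g1 *~ (m * wt n)) (m - m * wt n * u%:Z)) ->
  ext_equivalent (xi_ext u v t u' g1 g) X.
Proof.
move=> [[_ [[addA addC add0 addN] _]] _ [projD _] [incl_inj exact _] _].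
move=> FD F0 Fproj Fv Fdot.
have Fv_nat c n (k : nat) : F c (n + k%:Z * v%:Z) = F (c + g *+ k) n.
  elim: k c n => [|k IH] c n; first by rewrite mul0r mulr0n !addr0.
  rewrite mulrSr addrA -Fv -IH; congr F; rewrite -addn1 PoszD; ring.
have FvZ c n (k : int) : F c (n + k * v%:Z) = F (c + g *~ k) n.
  case: k => k; first exact: Fv_nat.
  rewrite NegzE mulrNz -[in RHS](subrK (k.+1%:Z * v%:Z) n) Fv_nat.
  by rewrite mulNr -pmulrn subrK.
(* Defined on the representative in [0, ..., v - 1]; [f_rho] gives independence of this choice. *)
pose f (x : E) := F (x.1 - g *~ carry v (x.2 : 'Z_v)%:Z) (x.2 : 'Z_v)%:Z.
have f_rho c n : f (rho c n) = F c n.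
  rewrite /f /=; have [k nE] := Zv_val_intr v_gt1 n.
  set a := (n%:~R : 'Z_v)%:Z in nE *; clearbody a.
  by rewrite nE carryDv // mulrzDr FvZ [_ + g *~ k]addrC addrA addrK.
have Fsub c c' n m : lcs_add (F c n) (F (- c') (- m)) = F (c - c') (n - m).
  by rewrite FD.
have F00 : F 0 0 = lcs_zero (ext_total X).
  have [y yF] := addN (F 0 0).
  by rewrite -[LHS]add0 -{1}yF -addA -FD !addr0.
exists f; split.
- have f_inj : injective f.
    move=> x y; have [c ->] := rho_surj x; have [d ->] := rho_surj y.
    rewrite !f_rho => cd.
    have : ext_proj (F c (x.2 : 'Z_v)%:Z) = ext_proj (F d (y.2 : 'Z_v)%:Z).
      by rewrite cd.
    rewrite !Fproj !Zv_valK // => xy; rewrite xy in cd *.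
    have := congr1 (fun z => lcs_add z (F (- 0) (- (y.2 : 'Z_v)%:Z))) cd.
    by rewrite !Fsub subrr !subr0 !F0 => /incl_inj ->.
  have f_surj e : exists x, f x = e.
    set a : 'Z_v := ext_proj e.
    (* [e - F 0 a] lies over 0, so it comes from [Gamma]. *)
    have [c cE] : exists c, lcs_add e (F 0 (- a%:Z)) = ext_incl X c.
      apply/exact; rewrite projD Fproj -/a /= intrN Zv_valK //.
      exact: subrr.
    exists (rho c a%:Z); rewrite f_rho -[c]addr0 -[a%:Z]add0r FD F0 -cE.
    by rewrite -addA -FD addr0 addNr F00 addC add0.
  exists (fun e => sval (cid (f_surj e))) => [x|e]; last by case: cid.
  by case: cid => y /= /f_inj.
- split=> x y; have [c ->] := rho_surj x; have [d ->] := rho_surj y.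
    by rewrite rhoD !f_rho FD.
  by rewrite rho_dot /lam !f_rho Fdot.
- by move=> c; rewrite /= -rho0 f_rho F0.
- by move=> x; have [c ->] := rho_surj x; rewrite f_rho Fproj.
Qed.
End Cocycles.

(* The j-th power of 1 for a o b = a + b + u a b is j + u 'C(j, 2) mod v, and
   2 (a - b + u ('C(a, 2) - 'C(b, 2))) = (a - b) (2 + u (a + b - 1)). *)
Lemma circ_generated (p nu eta u v : nat) : prime p -> (0 < nu)%N ->
  u = (p ^ nu)%N -> v = (p ^ eta)%N -> (2 < u)%N -> (u < v)%N ->
  forall n : int, exists (j : nat) (k : int),
    n = j%:Z + u%:Z * 'C(j, 2)%:Z + k * v%:Z.
Proof.
move=> p_prime nu_gt0 uE vE u_gt2 uv.
have v_gt1 : (1 < v)%N by lia.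
(* The [x]-th power of 1; on the finite set ['Z_v], injectivity makes every class a power. *)
pose h (x : 'Z_v) : 'Z_v := (x%:Z + u%:Z * 'C(x, 2)%:Z)%:~R.
have h_inj : injective h.
  move=> x y /(intr_Zv_eq v_gt1)[k].
  set a := nat_of_ord x; set b := nat_of_ord y => e.
  have a2 := bin2_int a; have b2 := bin2_int b.
  pose z := 2 + u%:Z * (a%:Z + b%:Z - 1).
  have e2 : (a%:Z - b%:Z) * z = 2 * k * v%:Z.
    transitivity (2 * (a%:Z + u%:Z * 'C(a, 2)%:Z) - 2 * (b%:Z + u%:Z * 'C(b, 2)%:Z)).
      rewrite !mulrDr !(mulrCA 2) !(mulrC 2 _%:Z) a2 b2 /z; ring.
    by rewrite e; ring.
  suff dv : (v%:Z %| a%:Z - b%:Z)%Z.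
    apply: val_inj; rewrite /= -/a -/b.
    have av : (a < v)%N by apply: ltn_Zv.
    have bv : (b < v)%N by apply: ltn_Zv.
    by move: dv; rewrite -eqz_mod_dvd !modz_small ?ltz_nat // => /eqP[].
  have coprime_v (w : int) : ~~ (p%:Z %| w)%Z -> coprimez v%:Z w.
    move=> pw; rewrite vE coprimezE /= coprimeXl // prime_coprime //.
  have pu : (p%:Z %| u%:Z)%Z.
    by rewrite uE; apply: (@dvdn_exp nu p p).
  (* For [p = 2], [u > 2] forces [4 %| u], so [z] is twice an odd number and the 2 cancels. For odd
     [p], [z] is 2 modulo [p], hence prime to [v]. *)
  have [p2|p2] := eqVneq p 2.
    have [w uw] : exists w, u = (2 * (2 * w))%N.
      move: u_gt2; rewrite uE p2; case: (nu) nu_gt0 => [|[|m]] // _ _.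
      by exists (2 ^ m)%N; rewrite !expnS.
    have zE : z = 2 * (1 + 2 * (w%:Z * (a%:Z + b%:Z - 1))).
      by rewrite /z uw !PoszM; ring.
    have : (v%:Z %| (a%:Z - b%:Z) * (1 + 2 * (w%:Z * (a%:Z + b%:Z - 1))))%Z.
      apply/dvdzP; exists k; apply: (@mulfI _ 2) => //.
      by rewrite mulrCA -zE e2 mulrA.
    rewrite Gauss_dvdzl // coprime_v // p2 rpredDr ?dvdz1 //.
    exact: dvdz_mulr.
  have : (v%:Z %| (a%:Z - b%:Z) * z)%Z by rewrite e2 dvdz_mull.
  rewrite Gauss_dvdzl // coprime_v // /z rpredDr; last exact: dvdz_mulr.
  rewrite /dvdz /=; apply/negP => /dvdn_leq => /(_ isT).
  by have := prime_gt1 p_prime; lia.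
move=> n; have [h' _ hK] := injF_bij h_inj.
exists (h' n%:~R); have := hK n%:~R; rewrite {1}/h => /esym.
by case/(intr_Zv_eq v_gt1) => k nE; exists k.
Qed.

(** * The addition of a cycle set as a [zmodType] *)

Section GroupOf.
Variables (T : Type) (zero : T) (add : T -> T -> T).
Hypothesis ab : is_abelian_group zero add.

(** The alias carries the proof as a parameter, so that the instances can be found from the type;
    opposites are chosen by [cid]. *)
Definition group_of of is_abelian_group zero add : Type := T.
Definition group_opp (x : T) : T :=
  let: And4 _ _ _ addN := ab in sval (cid (addN x)).

Lemma group_oppP (x : T) : add (group_opp x) x = zero.
Proof. by rewrite /group_opp; case: ab => ? ? ? ?; case: cid. Qed.

HB.instance Definition _ := gen_eqMixin (group_of ab).
HB.instance Definition _ := gen_choiceMixin (group_of ab).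

Let addA : associative (add : group_of ab -> group_of ab -> group_of ab).
Proof. by case: ab. Qed.
Let addC : commutative (add : group_of ab -> group_of ab -> group_of ab).
Proof. by case: ab. Qed.
Let add0 : left_id zero (add : group_of ab -> group_of ab -> group_of ab).
Proof. by case: ab. Qed.

HB.instance Definition _ :=
  GRing.isZmodule.Build (group_of ab) addA addC add0 group_oppP.
End GroupOf.

Lemma morphD_mulrz (U V : zmodType) (f : U -> V) : {morph f : x y / x + y} ->
  forall x k, f (x *~ k) = f x *~ k.
Proof.
move=> fD x; have f0 : f 0 = 0 by apply: (addrI (f 0)); rewrite -fD !addr0.
have fN y : f (- y) = - f y by apply: (addrI (f y)); rewrite -fD !subrr.
have fn (n : nat) : f (x *+ n) = f x *+ n.
  by elim: n => [|n IH]; rewrite ?mulr0n // !mulrS fD IH.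
by case=> n; rewrite ?NegzE ?mulrNz ?fN -!pmulrn fn.
Qed.

(** * Classification of the central extensions *)

Section Classify.
Variables (u v t u' : nat).
Hypotheses (v_eq : v = (t * u)%N) (u_eq : u = (u' * t)%N).
Hypotheses (t_gt1 : (1 < t)%N) (u_gt2 : (2 < u)%N).
Hypothesis gen : forall n : int, exists (j : nat) (k : int),
    n = j%:Z + u%:Z * 'C(j, 2)%:Z + k * v%:Z.
Variables (Gamma : zmodType) (X : extension Gamma (cyclic_lcs u v)).
Hypothesis cX : is_central_extension X.

Let v_gt1 : (1 < v)%N.
Proof. by rewrite v_eq ltnW // muln_gt2. Qed.

Lemma central_ext_equiv_xi : exists g g1 : Gamma, g1 *+ v = g *+ u /\
  ext_equivalent (xi_ext u v t u' g1 g) X.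
Proof.
have [[_ [ab [_ _ dotDr0 dotDl0]]] [inclD0 _] [projD0 projM0] [incl_inj exact surj] central] := cX.
pose E := group_of ab.
pose dot : E -> E -> E := @lcs_dot (ext_total X).
pose io : Gamma -> E := @ext_incl _ _ X.
pose pi : E -> 'Z_v := @ext_proj _ _ X.
have dotDr (a b c : E) : dot a (b + c) = dot a b + dot a c by exact: dotDr0.
have dotDl (a b c : E) : dot (a + b) c = dot (dot a b) (dot a c) by exact: dotDl0.
have ioD : {morph io : x y / x + y} by exact: inclD0.
have piD : {morph pi : x y / x + y} by exact: projD0.
have piM (a b : E) : pi (dot a b) = (1 - u%:R * pi a) * pi b by exact: projM0.
have io_inj : injective io by exact: incl_inj.
have piK (a : E) : pi a = 0 -> exists c, a = io c by move/exact.
have pi_io c : pi (io c) = 0 by apply/exact; exists c.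
have dotl0 c (a : E) : dot (io c) a = a by case: (central c a).
have dotr0 c (a : E) : dot a (io c) = io c by case: (central c a).
clear dotDr0 dotDl0 inclD0 projD0 projM0 exact central incl_inj.
have ioz := morphD_mulrz ioD.
have io0 : io 0 = 0 by have := ioz 0 0; rewrite !mulr0z.
have piz := morphD_mulrz piD.
have dotz a := morphD_mulrz (dotDr a).
have dot_io c (a b : E) : dot (io c + a) b = dot a b by rewrite dotDl !dotl0.
have [e pie] : exists e : E, pi e = 1 by exact: surj.
have [g gE] : exists g, e *~ v%:Z = io g.
  by apply: piK; rewrite piz pie -[1 *~ v%:Z]/(v%:R) natr_Zv0.
have [g1 g1E] : exists g1, dot e e - e *~ (1 - u%:Z) = io g1.
  apply: piK; rewrite -mulrNz piD piM piz pie -[u%:R]/(u%:Z%:~R) mulrNz.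
  by rewrite intrB !mulr1 subrr.
pose d := e *~ u%:Z - io g1.
have eeE : dot e e = e - d.
  by rewrite -(subrK (e *~ (1 - u%:Z)) (dot e e)) g1E /d mulrzBr; rewrite opprB addrCA.
have dotB a (x y : E) : dot a (x - y) = dot a x - dot a y.
  by rewrite dotDr -[- y]mulrN1z dotz mulrN1z.
have edE : dot e d = d *~ (1 - u%:Z).
  by rewrite {1}/d dotB dotr0 dotz eeE mulrzBl mulrzBr mulr1z /d addrAC.
have rel : g1 *+ v = g *+ u.
  have gM : (dot e e) *~ v%:Z = io g by rewrite -dotz gE dotr0.
  apply: io_inj; rewrite !pmulrn !ioz -g1E mulrzBl gM -mulrzA mulrC mulrzA gE.
  by rewrite mulrzBr mulr1z subKr.
(* [v d = u (v e) - v g1 = u g - v g1 = 0]. *)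
have dv k : d *~ (k * v%:Z) = 0.
  rewrite mulrC mulrzA /d mulrzBl -mulrzA mulrC mulrzA gE -!ioz.
  by rewrite -!pmulrn rel subrr mul0rz.
pose P (a : int) := dot (e *~ a) e = e - d *~ wt u a.
have Pmod a k : P a -> P (a + k * v%:Z).
  rewrite /P; have [q ->] := wt_modv u v a k.
  by rewrite !mulrzDr dv addr0 [k * _]mulrC mulrzA gE -ioz [e *~ a + _]addrC dot_io.
(* Passage from [a] to [a o 1]: since [(1 - u a) (1 + u a) = 1] modulo [v], [(a e) . ((1 + u a) e)]
   is [e] up to [Gamma]. So [(a o 1) e] acts as [a e] followed by [e]. *)
have Pstep a : P a -> P (a + (1 + u%:Z * a)).
  rewrite {1}/P => Pa.
  have [c cE] : exists c, dot (e *~ a) (e *~ (1 + u%:Z * a)) - e = io c.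
    apply: piK; rewrite -[- e]mulrN1z piD piM !piz pie mulrN1z.
    have au : u%:R * a%:~R = (u%:Z * a)%:~R :> 'Z_v by rewrite intrM.
    rewrite au intrD; set w := (u%:Z * a)%:~R.
    transitivity (- (w * w)); first by ring.
    rewrite /w -au; transitivity (- (u%:R * u%:R * (a%:~R * a%:~R)) : 'Z_v); first by ring.
    by rewrite (sqr_u_Zv v_eq u_eq t_gt1 u_gt2) mul0r oppr0.
  rewrite /P mulrzDr dotDl -[dot _ (_ *~ _)](subrK e) cE dot_io Pa dotB dotz.
  rewrite eeE edE -mulrzA -addrA; congr (_ + _); rewrite -opprD; congr (- _).
  rewrite -{1}[d]mulr1z -mulrzDr.
  pose q : int := - (3 * a ^+ 2 + u%:Z * a ^+ 2) * u'%:Z.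
  have -> : wt u (a + (1 + u%:Z * a)) = 1 + (1 - u%:Z) * wt u a + q * v%:Z.
    rewrite /q -[_ * v%:Z]mulrA -(sqr_u v_eq u_eq t_gt1 u_gt2) /wt; ring.
  by rewrite [RHS]mulrzDr dv addr0.
(* These are the powers of 1 starting from 0; [Pmod] absorbs the term [u ^ 2 'C(j, 2)], and [gen]
   then reaches every integer. *)
have Pj (j : nat) : P (j%:Z + u%:Z * 'C(j, 2)%:Z).
  elim: j => [|j /Pstep IH].
    by rewrite mulr0 addr0 /P /wt mulr0 mul0r subrr !mulr0z subr0 -io0 dotl0.
  have := Pmod _ (- ('C(j, 2)%:Z * u'%:Z)) IH; congr P.
  rewrite mulNr -mulrA -(sqr_u v_eq u_eq t_gt1 u_gt2).
  rewrite binS bin1 PoszD -(addn1 j) PoszD; ring.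
have Pall a : P a by have [j [k ->]] := gen a; apply: Pmod.
exists g, g1; split=> //.
apply: (ext_equiv_of_lift v_eq u_eq t_gt1 u_gt2 rel (F := fun c n => io c + e *~ n)) => //.
- by move=> c c' n n'; rewrite ioD mulrzDr addrACA.
- by move=> c; rewrite mulr0z addr0.
- by move=> c n; rewrite -/(pi _) piD pi_io add0r piz pie.
- by move=> c n; rewrite mulrzDr gE ioD [e *~ n + _]addrC addrA.
- move=> c c' n m; rewrite -[lcs_dot _ _]/(dot _ _) dot_io dotDr dotr0 dotz Pall.
  rewrite ioD ioz -[RHS]addrA; apply: (congr1 (fun z => io c' + z)).
  rewrite mulrzBl mulrzBr addrCA; apply: (congr1 (fun z => e *~ m + z)).
  rewrite -mulrzA [_ * m]mulrC /d mulrzBl opprB -mulrzA mulrC.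
  by congr (_ - _ *~ _); ring.
Qed.
End Classify.

(** * Equivalences between the extensions [xi_ext] *)

Lemma ext_equivalent_sym (Gamma : zmodType) (A : lcsData)
    (X Y : extension Gamma A) : ext_equivalent X Y -> ext_equivalent Y X.
Proof.
case=> f [[f' fK f'K] [fD fM] fi fp].
exists f'; split.
- by exists f.
- by split=> x y; apply: (can_inj fK); rewrite ?fD ?fM !f'K.
- by move=> c; rewrite -fi fK.
- by move=> e; rewrite -fp f'K.
Qed.

Section Compare.
Variables (u v t u' : nat).
Hypotheses (v_eq : v = (t * u)%N) (u_eq : u = (u' * t)%N).
Hypotheses (t_gt1 : (1 < t)%N) (u_gt2 : (2 < u)%N).
Variables (Gamma : zmodType) (g g1 g' g1' : Gamma).
Hypotheses (rel : g1 *+ v = g *+ u) (rel' : g1' *+ v = g' *+ u).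

Let v_gt2 : (2 < v)%N.
Proof. by rewrite v_eq muln_gt2. Qed.
Let v_gt1 : (1 < v)%N := ltnW v_gt2.
Let v_gt0 : (0 < v)%N := ltnW v_gt1.

Let r := @rho u v t u' Gamma g1 g.
Let r' := @rho u v t u' Gamma g1' g'.

(** The equivalence sends [e] to [c0 + e']. The second hypothesis says [g = g' + v c0], since
    [t u = v]. *)
Lemma xi_equiv_sufficient (c0 : Gamma) :
  g1 - g1' = c0 *+ u -> (g1 - g1') *+ t = g - g' ->
  ext_equivalent (xi_ext u v t u' g1 g) (xi_ext u v t u' g1' g').
Proof.
move=> d1 d; have {d} d : g - g' = c0 *+ v by rewrite -d d1 -mulrnA mulnC -v_eq.
have {}d1 : g1 = g1' + c0 *+ u by rewrite -d1 addrC subrK.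
have {}d : g = g' + c0 *+ v by rewrite -d addrC subrK.
apply: (ext_equiv_of_lift v_eq u_eq t_gt1 u_gt2 rel
  (X := xi_ext u v t u' g1' g')
  (F := fun c n => r' (c + c0 *~ n) n)).
- exact: (xi_central v_eq u_eq).
- move=> c c' n n'; rewrite -[lcs_add _ _]/(@lcs_add (xi_lcs u v t u' g1' g') _ _).
  by rewrite (rhoD v_eq u_eq) // mulrzDr addrACA.
- by move=> c; rewrite mulr0z addr0 /r' (rho0 v_eq u_eq).
- by [].
- move=> c n; rewrite -[v%:Z]mul1r /r' (rhoDv _ v_eq) // mulr1z mul1r mulrzDr.
  congr rho; rewrite d -pmulrn -!addrA; congr (_ + _).
  by rewrite addrC [_ + g']addrC -addrA.
- move=> c c' n m.
  rewrite -[lcs_dot _ _]/(@lcs_dot (xi_lcs u v t u' g1' g') _ _).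
  rewrite (rho_dot v_eq u_eq) // /lam; congr rho.
  rewrite mulrzBr d1 mulrzDl -!addrA; congr (_ + _).
  rewrite addrC; congr (_ + _).
  by rewrite pmulrn -mulrzA [u%:Z * _]mulrC addrCA subrr addr0.
Qed.

(** An equivalence preserves the class 1, so it sends [e] to some [c0 + e']; the images of [v e] and
    [e . e] determine [g] and [g1]. *)
Lemma xi_equiv_necessary :
  ext_equivalent (xi_ext u v t u' g1 g) (xi_ext u v t u' g1' g') ->
  exists c0 : Gamma, g1 - g1' = c0 *+ u /\ (g1 - g1') *+ t = g - g'.
Proof.
case=> f [_ [fD fM] fi fp].
have f0 c : f (r c 0) = r' c 0 by rewrite /r /r' !(rho0 v_eq u_eq) //; apply: fi.
have {}fD c d n m : f (r (c + d) (n + m)) = lcs_add (f (r c n)) (f (r d m)).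
  by rewrite -fD (rhoD v_eq u_eq).
have carry1 : carry v 1 = 0 by apply: carryP => //; lia.
have [c0 fe] : exists c0, f (r 0 1) = r' c0 1.
  exists (f (r 0 1)).1; rewrite /r' /rho carry1 mulr0z addr0.
  by have := fp (r 0 1); case: (f _) => a b /= ->.
have fn (n : nat) : f (r 0 n) = r' (c0 *+ n) n.
  elim: n => [|n IH]; first by rewrite f0.
  rewrite -addn1 PoszD -[X in r X _]addr0 fD IH fe.
  by rewrite mulrnDr mulr1n; apply: (rhoD v_eq u_eq).
(* Both sides are the image of [v e = g]. *)
have gE : g = c0 *+ v + g'.
  have := fn v; rewrite -[v%:Z]mul1r -[X in r _ X]add0r -[X in r' _ X]add0r.
  rewrite /r /r' !(rhoDv _ v_eq) // !mulr1z add0r.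
  by rewrite -/r f0 => /rho_inj.
(* From [e . e = g1 + (1 - u) e]; adding [u e] brings the image back over 1. *)
have g1E : g1 = g1' + c0 *+ u.
  have e1 : lcs_dot (r 0 1) (r 0 1) = r g1 (1 - u%:Z).
    by rewrite /r (rho_dot v_eq u_eq) // /lam wt1 !mul1r mulr1z add0r.
  have e2 : lcs_dot (r' c0 1) (r' c0 1) = r' (c0 + g1') (1 - u%:Z).
    by rewrite /r' (rho_dot v_eq u_eq) // /lam wt1 !mul1r mulr1z.
  have e3 : f (r g1 (1 - u%:Z)) = r' (c0 + g1') (1 - u%:Z).
    by rewrite -e1 fM fe; apply: e2.
  have := fD g1 0 (1 - u%:Z) u%:Z; rewrite subrK addr0 e3 fn.
  rewrite -[X in r X _]addr0 -[X in r _ X]add0r fD f0 fe.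
  rewrite -[lcs_add _ _]/(@lcs_add (xi_lcs u v t u' g1' g') _ _).
  rewrite -[RHS]/(@lcs_add (xi_lcs u v t u' g1' g') _ _).
  rewrite !(rhoD v_eq u_eq) // add0r subrK => /rho_inj.
  by rewrite addrC -addrA => /addrI.
exists c0; split; first by rewrite g1E addrC addKr.
by rewrite g1E gE addrK [_ - g1']addrC addKr -mulrnA mulnC -v_eq.
Qed.
End Compare.

Theorem theoremB (p nu eta u v t u' : nat) (Gamma : zmodType)
    (p_prime : prime p)
    (nu_gt0 : (0 < nu)%N) (le_nu_eta : (nu <= eta)%N)
    (le_eta_2nu : (eta <= 2 * nu)%N)
    (u_def : u = (p ^ nu)%N) (v_def : v = (p ^ eta)%N)
    (t_def : t = (p ^ (eta - nu))%N) (u'_def : u' = (p ^ (2 * nu - eta))%N)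
    (u_gt2 : (2 < u)%N) (lt_u_v : (u < v)%N) :
  (forall g g1 : Gamma, g1 *+ v = g *+ u ->
     is_central_extension (xi_ext u v t u' g1 g)) /\
  ((forall g g1 g' g1' : Gamma, g1 *+ v = g *+ u -> g1' *+ v = g' *+ u ->
      ext_equivalent (xi_ext u v t u' g1 g) (xi_ext u v t u' g1' g') <->
      ((exists c : Gamma, g1 - g1' = c *+ u) /\ (g1 - g1') *+ t = g - g')) /\
   (forall X : extension Gamma (cyclic_lcs u v), is_central_extension X ->
      exists g g1 : Gamma, g1 *+ v = g *+ u /\
        ext_equivalent X (xi_ext u v t u' g1 g))).
Proof.
have v_eq : v = (t * u)%N by rewrite v_def t_def u_def -expnD subnK.
have u_eq : u = (u' * t)%N.
  by rewrite u_def u'_def t_def -expnD; congr (_ ^ _)%N; lia.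
have t_gt1 : (1 < t)%N by move: lt_u_v; rewrite v_eq; nia.
split; [|split].
- by move=> g g1 rel; apply: (xi_central v_eq u_eq).
- move=> g g1 g' g1' rel rel'; split.
    case/(xi_equiv_necessary v_eq u_eq t_gt1 u_gt2 rel rel') => c0 [d1 d].
    by split=> //; exists c0.
  by case=> [[c0 d1] d]; apply: (xi_equiv_sufficient v_eq u_eq) d1 d.
- move=> X cX.
  have gen := circ_generated p_prime nu_gt0 u_def v_def u_gt2 lt_u_v.
  have [g [g1 [rel eqv]]] := central_ext_equiv_xi v_eq u_eq t_gt1 u_gt2 gen cX.
  by exists g, g1; split=> //; apply: ext_equivalent_sym.
Qed.
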